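(* For every $1<r<\infty$ there exists an unweighted 1-2 tree whose critical exponent satisfies $p_c=r$.
   Context: A rooted tree with root $o$: the generation of an edge $e$ is the number of edges on the unique path from $o$ ending with $e$; $e$ is the parent of $e'$ ($e'$ a child of $e$) if they are adjacent and $e'$ has generation one more than $e$. A proper infinite tree is infinite, locally finite, and every edge has at least one child; it is radially symmetric if the number of children of an edge depends only on its generation. A 1-2 tree is a radially symmetric proper infinite tree in which every edge has either one or two children. $S_k$ is the set of edges of generation $k$. A descending path is a path $e_1e_2\cdots$ from $o$ with $e_i$ the parent of $e_{i+1}$; $\Gamma_\infty$ is the set of infinite descending paths. For a density $\rho:E\to[0,\infty)$, $\ell_\rho(\gamma)=\sum_{e\in\gamma}\rho(e)$; $\rho$ is admissible if $\ell_\rho(\gamma)\ge1$ for all $\gamma\in\Gamma_\infty$. For $1<p<\infty$, the unweighted modulus is $\mathrm{Mod}_{p,1}(\Gamma_\infty)=\inf\{\sum_{e\in E}\rho(e)^p:\rho \text{ admissible}\}$. The critical exponent is $p_c=\sup\{p>1:\mathrm{Mod}_{p,1}(\Gamma_\infty)>0\}$, with $p_c=1$ if this set is empty and $p_c=+\infty$ if it is all of $(1,\infty)$. *)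

(* Defs.v *)
From HB Require Import structures.
From mathcomp Require Import all_boot all_order all_algebra.
From mathcomp Require Import all_classical all_reals all_analysis.
Set Implicit Arguments.
Unset Strict Implicit.
Unset Printing Implicit Defensive.
Import Order.TTheory GRing.Theory Num.Theory.
Local Open Scope classical_set_scope.
Local Open Scope ring_scope.

(* As in [path], a path is given by its first vertex x and the sequence p of
   its other vertices. *)
Definition simple_path (V : eqType) (adj : rel V) (x : V) (p : seq V) : bool :=
  path adj x p && uniq (x :: p).

Record rooted_tree := RootedTree {
  vertex :> choiceType;
  adj : rel vertex;
  root : vertex;
  adj_sym : symmetric adj;
  adj_irr : irreflexive adj;
  adj_tree : forall x y : vertex,
    exists! p : seq vertex, simple_path adj x p /\ last x p = y }.

Section Tree.
Variable T : rooted_tree.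

(* An edge is the unordered pair of its endpoints, as a set of vertices. *)
Definition edges : set (set T) := [set e | exists x y, adj x y /\ e = [set x; y]].

Definition path_edges (x : T) (p : seq T) : seq (set T) :=
  pairmap (fun u v => [set u; v]) x p.

(* S_k; "e has generation k" is rendered as [edges_of_gen k e]. *)
Definition edges_of_gen (k : nat) : set (set T) :=
  [set e | exists p : seq T,
    [/\ simple_path (@adj T) (root T) p, size p = k
      & exists es, path_edges (root T) p = rcons es e]].

Definition adjacent_edges (e f : set T) : Prop := e <> f /\ e `&` f !=set0.

Definition is_parent (e f : set T) : Prop :=
  adjacent_edges e f /\
  exists k, edges_of_gen k e /\ edges_of_gen k.+1 f.

Definition children (e : set T) : set (set T) := [set f | is_parent e f].

Definition locally_finite : Prop :=
  forall x : T, finite_set [set y | adj x y].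

Definition proper_infinite_tree : Prop :=
  [/\ infinite_set [set: T], locally_finite
    & forall e, edges e -> children e !=set0].

Definition radially_symmetric : Prop :=
  forall k e f, edges_of_gen k e -> edges_of_gen k f ->
    (children e #= children f)%card.

Definition one_two_tree : Prop :=
  [/\ proper_infinite_tree, radially_symmetric
    & forall e, edges e ->
        (children e #= `I_1)%card \/ (children e #= `I_2)%card].

(* Gamma_infty; the edge e_i is [gamma (i - 1)]. *)
Definition infinite_descending_paths : set (nat -> set T) :=
  [set gamma | edges (gamma 0%N) /\ gamma 0%N (root T) /\
               forall i, is_parent (gamma i) (gamma i.+1)].

Variable R : realType.

(* A density is a function on all sets of vertices, of which only the values
   on [edges] are constrained and used. *)
Definition density (rho : set T -> R) : Prop :=
  forall e, edges e -> 0 <= rho e.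

(* The edges of a descending path are pairwise distinct, so that the sum over
   its edges is the sum over its indices. *)
Definition rho_length (rho : set T -> R) (gamma : nat -> set T) : \bar R :=
  (\sum_(0 <= i <oo) (rho (gamma i))%:E)%E.

Definition admissible : set (set T -> R) :=
  [set rho | density rho /\
    forall gamma, infinite_descending_paths gamma ->
      (1%:E <= rho_length rho gamma)%E].

Definition modulus (p : R) : \bar R :=
  ereal_inf [set (\esum_(e in edges) (rho e `^ p)%:E)%E | rho in admissible].

Definition positive_modulus_exponents : set R :=
  [set p | 1 < p /\ (0 < modulus p)%E].

(* The supremum is taken in \bar R, hence is +oo when the set is all of
   ]1, +oo[. The empty set is singled out since [ereal_sup set0] is -oo. *)
Definition critical_exponent : \bar R :=
  if positive_modulus_exponents == set0 then 1%:E
  else ereal_sup (EFin @` positive_modulus_exponents).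

End Tree.

(* Main.v *)
Require Import Defs.
From HB Require Import structures.
From mathcomp Require Import all_boot all_order all_algebra.
From mathcomp Require Import all_classical all_reals all_analysis.
From mathcomp Require Import zify lra ring.
Import Order.TTheory GRing.Theory Num.Theory.
Set Implicit Arguments.
Unset Strict Implicit.
Unset Printing Implicit Defensive.
Local Open Scope classical_set_scope.
Local Open Scope ring_scope.

(* Let N k be the number of edges of generation k. We choose the doublings
   greedily so that N k is, up to a factor 2, the value at k of a polynomial
   growth (1 + h k)^(r-1).
   If p > r, the density equal to 1/n on the first n generations is admissible
   and has energy at most n N(n) / n^p = O(n^(r-p)), which tends to 0.
   If p < r, let rho be admissible with energy E. Going down to a child whose
   subtree carries the least energy yields a path e_1 e_2 ... such that
   sum_k N(k) rho(e_k)^p <= E. For weights w_k > 0 one has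
   rho <= w_k + w_k^(1-p) rho^p, and for w_k of order k^(-(r-1)/(p-1)), which
   is summable, w_k^(1-p) is at most C N(k). Scaling w to have sum at most 1/2,
   1 <= sum_k rho(e_k) <= 1/2 + C E bounds E from below. *)

(** * Trees given by a depth and a parent function *)

Section ParentTree.
Variables (V : choiceType) (o : V) (dep : V -> nat) (par : V -> V).
Hypothesis dep_eq0 : forall x, (dep x == 0%N) = (x == o).
Hypothesis dep_par : forall x, dep (par x) = (dep x).-1.

(** By [dep_par] and [dep_eq0] the root is its own parent; the condition on depths keeps it from
    being its own child. *)
Definition is_child (x y : V) : bool := (par y == x) && (dep y == (dep x).+1).

Definition parent_adj (x y : V) : bool := is_child x y || is_child y x.

Lemma is_child_par x : x != o -> is_child (par x) x.
Proof.
by rewrite -dep_eq0 /is_child eqxx dep_par -lt0n => /prednK->/=.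
Qed.

Lemma is_child_dep x y : is_child x y -> dep y = (dep x).+1.
Proof. by move=> /andP[_ /eqP]. Qed.

Lemma parent_adj_sym : symmetric parent_adj.
Proof. by move=> x y; rewrite /parent_adj orbC. Qed.

Lemma parent_adj_irr : irreflexive parent_adj.
Proof. by move=> x; rewrite /parent_adj /is_child orbb; lia. Qed.

Lemma path_from_root x :
  exists p, [/\ path is_child o p, last o p = x & size p = dep x].
Proof.
have [n] := ubnP (dep x); elim: n x => // n IH x ltxn.
have [->|nx] := eqVneq x o.
  by exists [::]; split=> //=; apply/esym/eqP; rewrite dep_eq0.
have /is_child_dep dx := is_child_par nx.
have [|p [pp lp sp]] := IH (par x); first by lia.
exists (rcons p x); rewrite rcons_path pp lp is_child_par //= last_rcons.
by rewrite size_rcons sp dx.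
Qed.

Lemma is_child_path_uniq x p : path is_child x p -> uniq (x :: p).
Proof.
move=> pp; apply: (@map_uniq _ _ dep).
apply: (@sorted_uniq _ ltn ltn_trans ltnn) => /=.
by rewrite path_map; apply: sub_path pp => u v /is_child_dep /= ->.
Qed.

(* A step down can only be followed by a step down, as the only step up leads
   back to the vertex just left. *)
Lemma down_path x c p : is_child x c -> path parent_adj c p ->
  uniq [:: x, c & p] -> path is_child c p.
Proof.
elim: p x c => //= d p IH x c xc /andP[/orP[cd|dc] pp].
  by move=> /andP[_ up]; rewrite cd (IH c).
case/andP: xc dc => /eqP px _ /andP[/eqP pd _].
by rewrite inE inE -pd px eqxx orbT.
Qed.

Lemma is_child_path_dep x p : path is_child x p ->
  dep (last x p) = (dep x + size p)%N.
Proof.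
elim: p x => [|y p IH] x /=; first by rewrite addn0.
by move=> /andP[/is_child_dep xy /IH->]; rewrite xy addSnnS.
Qed.

(** If the first step went down, all later ones would too by [down_path], and the path would end
    strictly deeper than [x]. *)
Lemma first_step_up x c p : path parent_adj x (c :: p) -> uniq [:: x, c & p] ->
  (dep (last c p) <= dep x)%N -> c = par x.
Proof.
move=> /= /andP[/orP[xc|/andP[/eqP-> //]] pp] up le.
have /is_child_path_dep := down_path xc pp up.
by have := is_child_dep xc; lia.
Qed.

(** This is [first_step_up] for the reversed path, which starts at [y]. *)
Lemma last_step_down x y p : path parent_adj x (rcons p y) ->
  uniq (x :: rcons p y) -> (dep x <= dep y)%N -> last x p = par y.
Proof.
move=> pp up le.
have [c [q E]] : exists c q, rev (x :: rcons p y) = [:: y, c & q].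
  rewrite rev_cons rev_rcons /=.
  by case: (rev p) => [|c q]; [exists x, [::]|exists c, (rcons q x)].
have := up; rewrite -rev_uniq E => uq.
have Hl : last c q = x.
  by have := congr1 (last x) E; rewrite rev_cons last_rcons /= => <-.
have Hc : c = last x p.
  have := congr1 (fun s => head x (behead s)) E.
  rewrite rev_cons rev_rcons /= => <-.
  by case: (lastP p) => //= ? ?; rewrite rev_rcons last_rcons.
rewrite -Hc; apply: first_step_up uq _; last by rewrite Hl.
have /(congr1 behead) : rev (x :: rcons p y) = [:: y, c & q] by [].
have := rev_path parent_adj x (rcons p y).
rewrite last_rcons.
have -> : rev (belast x (rcons p y)) = c :: q.
  by move: E; rewrite lastI last_rcons rev_rcons => -[].
move=> + _; move=> ->.
rewrite -(eq_path (e := parent_adj)) // => u v; exact: parent_adj_sym.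
Qed.

Lemma simple_path_ends x p : simple_path parent_adj x p -> last x p = x ->
  p = [::].
Proof.
case/andP => _; case: (lastP p) => // q z /=.
by rewrite mem_rcons last_rcons inE => /andP[+ _] zx; rewrite zx eqxx.
Qed.

(** Induction on the sum of the depths of the endpoints: at the deeper endpoint the path must pass
    through its parent, so both paths can be shortened by the same step there. *)
Lemma simple_path_unique x y p q :
  simple_path parent_adj x p -> last x p = y ->
  simple_path parent_adj x q -> last x q = y -> p = q.
Proof.
have [n] := ubnP (dep x + dep y); elim: n x y p q => // n IH x y p q ltn.
have [<-|nxy] := eqVneq x y.
  move=> hp lp hq lq.
  by rewrite (simple_path_ends hp lp) (simple_path_ends hq lq).
have [lexy|ltxy] := leqP (dep y) (dep x); last first.
  have nyo : y != o by rewrite -dep_eq0; lia.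
  have /is_child_dep dy := is_child_par nyo.
  have aux s : simple_path parent_adj x s -> last x s = y ->
      exists2 s', s = rcons s' y &
        simple_path parent_adj x s' /\ last x s' = par y.
    case: (lastP s) => [|s' z]; first by move=> _ /= /eqP; rewrite (negPf nxy).
    rewrite last_rcons => + zy; rewrite {}zy => /andP[ps us]; exists s' => //.
    split; last by apply: last_step_down us _ => //; exact: ltnW.
    move: ps us; rewrite rcons_path => /andP[ps' _].
    by rewrite -rcons_cons rcons_uniq => /andP[_ us']; apply/andP.
  move=> hp lp hq lq.
  have [p' -> [hp' lp']] := aux _ hp lp; have [q' -> [hq' lq']] := aux _ hq lq.
  by rewrite (IH x (par y) p' q') //; move: ltn; rewrite dy; lia.
have nxo : x != o.
  apply: contra nxy => /eqP xo; move: lexy; rewrite eq_sym xo.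
  by have /eqP -> := etrans (dep_eq0 o) (eqxx o); rewrite leqn0 dep_eq0.
have /is_child_dep dx := is_child_par nxo.
have aux s : simple_path parent_adj x s -> last x s = y ->
    exists2 s', s = par x :: s' &
      simple_path parent_adj (par x) s' /\ last (par x) s' = y.
  case: s => [|c s] /=; first by move=> _ /= /eqP; rewrite (negPf nxy).
  case/andP=> ps us ls.
  have cx : c = par x by apply: first_step_up ps us _; rewrite ls.
  rewrite cx in ps us ls *; exists s => //; split => //.
  by apply/andP; move: ps us => /= /andP[_ ->] /andP[_ ->].
move=> hp lp hq lq.
have [p' -> [hp' lp']] := aux _ hp lp; have [q' -> [hq' lq']] := aux _ hq lq.
by rewrite (IH (par x) y p' q') //; move: ltn; rewrite dx; lia.
Qed.

(** For existence, climb from [x] to the root, descend to [y], and cut out the loops. *)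
Lemma parent_adj_tree x y :
  exists! p : seq V, simple_path parent_adj x p /\ last x p = y.
Proof.
have [p [pp lp _]] := path_from_root x; have [q [pq lq _]] := path_from_root y.
have path_up : path parent_adj x (rev (belast o p)).
  rewrite -lp rev_path; apply: sub_path pp => u v uv /=.
  by rewrite /parent_adj uv orbT.
have pathxy : path parent_adj x (rev (belast o p) ++ q).
  rewrite cat_path path_up /=.
  have -> : last x (rev (belast o p)) = o.
    by case: p lp {pp path_up} => [<-//|? ?] _; rewrite rev_cons last_rcons.
  by apply: sub_path pq => u v uv; rewrite /parent_adj uv.
have lastxy : last x (rev (belast o p) ++ q) = y.
  rewrite last_cat.
  case: p lp {pp path_up pathxy} => [<-//|? ?] _.
  by rewrite rev_cons last_rcons.
move: lastxy; case: (shortenP pathxy) => s ps us _ ls.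
have hs : simple_path parent_adj x s by apply/andP.
by exists s; split=> // t [ht lt]; apply: simple_path_unique hs ls ht lt.
Qed.

(** * Edges, generations and descending paths of these trees *)

Definition parent_tree : rooted_tree :=
  RootedTree o parent_adj_sym parent_adj_irr parent_adj_tree.

Local Notation T := parent_tree.

(** Edges are indexed by their lower endpoint, so that sums over edges become sums over the vertices
    other than the root. *)
Definition parent_edge (v : V) : set V := [set par v; v].

Lemma dep_gt0 v : v != o -> (0 < dep v)%N.
Proof. by rewrite lt0n dep_eq0. Qed.

(** Otherwise [x] and [y] would be parents of each other, against the depths. *)
Lemma parent_edge_inj x y : x != o -> y != o ->
  parent_edge x = parent_edge y -> x = y.
Proof.
move=> /dep_gt0 dx /dep_gt0 dy E.
have : parent_edge y x by rewrite -E; right.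
have : parent_edge x y by rewrite E; right.
case=> // yx [] // xy.
by move: (dep_par x) (dep_par y); rewrite -xy -yx; lia.
Qed.

Lemma is_child_neq_root x y : is_child x y -> y != o.
Proof. by move=> /is_child_dep dy; rewrite -dep_eq0 dy. Qed.

Lemma is_child_edge x y : is_child x y -> [set x; y] = parent_edge y.
Proof. by case/andP => /eqP <-. Qed.

Lemma parent_tree_edges : @edges T = parent_edge @` [set v | v != o].
Proof.
apply/seteqP; split => e /=.
  case=> x [y [/orP[xy|yx] ->]].
    by exists y; [exact: is_child_neq_root xy|rewrite (is_child_edge xy)].
  by exists x; [exact: is_child_neq_root yx|rewrite -(is_child_edge yx) setUC].
case=> v vo <-; exists (par v), v; split => //=.
by rewrite /parent_adj is_child_par.
Qed.

Lemma root_path_down p :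
  simple_path (@adj T) (Defs.root T) p -> path is_child o p.
Proof.
case: p => //= c p /andP[/= /andP[/orP[oc|co] pp] up].
  by rewrite oc /=; exact: (down_path oc pp up).
by have := is_child_neq_root co; rewrite eqxx.
Qed.

Lemma parent_tree_edges_of_gen k : @edges_of_gen T k =
  parent_edge @` [set v | v != o /\ dep v = k].
Proof.
have dep0 : dep o = 0%N by apply/eqP; rewrite dep_eq0.
apply/seteqP; split => e /=.
  case=> p [/root_path_down pp sp [es]].
  case: (lastP p) pp sp => [|q v]; first by case: es.
  move=> /[dup] pp' /is_child_path_dep dp.
  rewrite last_rcons dep0 add0n in dp.
  move: pp'; rewrite rcons_path => /andP[pq lv] sp.
  have -> : path_edges (Defs.root T) (rcons q v) =
      rcons (@path_edges T (Defs.root T) q) [set last o q; v].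
    by rewrite /path_edges -cats1 pairmap_cat /= cats1.
  move=> /rcons_inj[_ <-]; exists v.
    by rewrite dp sp; split=> //; exact: is_child_neq_root lv.
  by rewrite is_child_edge.
case=> v [vo dv] <-.
have [q [pq lq sq]] := path_from_root (par v).
have lv := is_child_par vo.
have pq' : path is_child o (rcons q v) by rewrite rcons_path pq lq.
exists (rcons q v); split.
- apply/andP; split; last exact: is_child_path_uniq pq'.
  by apply: sub_path pq' => a b ab /=; rewrite /parent_adj ab.
- by rewrite size_rcons sq dep_par prednK ?dep_gt0.
- exists (@path_edges T o q).
  by rewrite /path_edges -cats1 pairmap_cat /= cats1 lq.
Qed.

Lemma parent_edge_gen v : v != o -> @edges_of_gen T (dep v) (parent_edge v).
Proof. by move=> vo; rewrite parent_tree_edges_of_gen; exists v. Qed.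

Lemma edges_of_gen_inj k l e :
  @edges_of_gen T k e -> @edges_of_gen T l e -> k = l.
Proof.
rewrite !parent_tree_edges_of_gen => -[v [vo <-] <-] [w [wo <-]].
by move/(parent_edge_inj wo vo) ->.
Qed.

Lemma parent_edge_is_parent u v : u != o ->
  @is_parent T (parent_edge u) (parent_edge v) <-> is_child u v.
Proof.
move=> uo; split; last first.
  move=> uv; have vo := is_child_neq_root uv.
  split; last first.
    exists (dep u); rewrite -(is_child_dep uv).
    by split; exact: parent_edge_gen.
  split; last by exists u; split; [right|left; case/andP: uv => /eqP].
  move/(parent_edge_inj uo vo) => uv'.
  by have := is_child_dep uv; rewrite uv'; lia.
case=> -[neq [x [ux vx]]] [k []]; rewrite !parent_tree_edges_of_gen.
move=> [u' [uo' du] /(parent_edge_inj uo' uo) uE].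
move=> [v' [vo' dv] vE]; rewrite {}uE in uo' du.
have dpu := dep_par u; have dpv := dep_par v'; have du0 := dep_gt0 uo.
(* The endpoints of the first edge have depths k-1 and k, those of the second k and k+1. The common
   vertex thus has depth k: it is the lower end of the first and the upper end of the second. *)
have E : par v' = u.
  have dx1 : dep x = k \/ dep x = k.-1.
    by case: ux => ->; [right; rewrite dpu du|left].
  move: vx; rewrite -vE => -[|] xE; last by move: dx1; rewrite xE; lia.
  by case: ux => // ux; last rewrite -ux xE // ; move: dpv; rewrite -xE ux; lia.
have vv : v' = v.
  have vo : v != o.
    rewrite -dep_eq0; have : parent_edge v' v by rewrite vE; right.
    by case=> ->; lia.
  exact: parent_edge_inj vE.
by rewrite /is_child -vv E eqxx dv du eqxx.
Qed.

Lemma parent_edge_children u : u != o ->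
  @children T (parent_edge u) = parent_edge @` [set v | is_child u v].
Proof.
move=> uo; apply/seteqP; split => f /=.
  move=> pf; have : @edges T f.
    case: pf => _ [k [_]]; rewrite parent_tree_edges_of_gen parent_tree_edges.
    by case=> v [vo _] <-; exists v.
  rewrite parent_tree_edges => -[v vo vf]; exists v => //=.
  by apply/parent_edge_is_parent => //; rewrite vf.
by case=> v uv <-; apply/parent_edge_is_parent.
Qed.

Lemma children_card u : u != o ->
  (@children T (parent_edge u) #= [set v | is_child u v])%card.
Proof.
move=> uo; rewrite parent_edge_children //; apply: inj_card_eq => v w.
move=> /set_mem /is_child_neq_root vo /set_mem /is_child_neq_root wo.
exact: parent_edge_inj.
Qed.

Lemma descending_gen gamma i : @infinite_descending_paths T gamma ->
  @edges_of_gen T i.+1 (gamma i).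
Proof.
case=> e0 [g0 pg]; elim: i => [|i IH]; last first.
  by have [_ [k [gk gk1]]] := pg i; rewrite -(edges_of_gen_inj IH gk) in gk1.
move: e0 g0; rewrite parent_tree_edges parent_tree_edges_of_gen => -[v vo <-].
have d0 : dep o = 0%N by apply/eqP; rewrite dep_eq0.
have dv := dep_gt0 vo; have dpv := dep_par v.
case=> /= oE; last by move: dv; rewrite -oE d0.
by exists v => //; split => //; move: dpv; rewrite -oE d0; lia.
Qed.

Lemma descending_of_vertices (v : nat -> V) : v 0%N = o ->
  (forall i, is_child (v i) (v i.+1)) ->
  @infinite_descending_paths T (fun i => parent_edge (v i.+1)).
Proof.
move=> v0 vc; have vo i : v i.+1 != o by exact: is_child_neq_root (vc i).
split; first by rewrite parent_tree_edges; exists (v 1%N); first exact: vo.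
split; first by left; have /andP[/eqP -> _] := vc 0%N; rewrite v0.
by move=> i; apply/parent_edge_is_parent; [exact: vo|exact: vc].
Qed.

Lemma esum_parent_tree_edges (R : realType) (g : set V -> \bar R) :
  (\esum_(e in @edges T) g e =
   \esum_(v in [set v | v != o]) g (parent_edge v))%E.
Proof.
rewrite parent_tree_edges esum_image // => x y /set_mem xo /set_mem yo.
exact: parent_edge_inj.
Qed.

End ParentTree.

(** * Sums, means and a Young-type inequality *)

Lemma le_esum_subset (R : realType) (I : choiceType) (A B : set I)
  (g : I -> \bar R) : A `<=` B -> (\esum_(i in A) g i <= \esum_(i in B) g i)%E.
Proof.
move=> AB; apply: le_ereal_sup => _ [F [finF FA] <-].
by exists F => //; split=> //; exact: subset_trans AB.
Qed.

Lemma le_mean_argmin (R : realType) n (G : nat -> \bar R) : (0 < n)%N ->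
  (forall j, 0 <= G j)%E ->
  exists2 j, (j < n)%N & (n%:R%:E * G j <= \sum_(i < n) G i)%E.
Proof.
case: n => // n _ G0.
case: (@Order.TotalTheory.arg_minP _ (\bar R) 'I_n.+1 ord0 xpredT
  (fun i => G i) isT) => /= j _ jmin.
have natE (x : \bar R) : (n.+1%:R%:E * x = \sum_(i < n.+1) x)%E.
  rewrite -[in LHS](card_ord n.+1) -sum1_card natr_sum -sumEFin.
  rewrite ge0_sume_distrl //.
  by apply: eq_bigr => i _; rewrite mul1e.
by exists j => //; rewrite natE; apply: lee_sum => i _; exact: jmin.
Qed.

(** If x <= w the first term suffices; otherwise K x^(p-1) >= K w^(p-1) >= 1, and multiplying by x
    makes the second term suffice. *)
Lemma le_weight_powR (R : realType) (p K w x : R) : 1 < p -> 0 < w -> 0 <= x ->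
  1 <= K * w `^ (p - 1) -> x <= w + K * x `^ p.
Proof.
move=> p1 w0 x0 Kw.
have K0 : 0 <= K.
  rewrite -(pmulr_lge0 _ (powR_gt0 (p - 1) w0)); exact: le_trans ler01 Kw.
have [xw|wx] := leP x w.
  by apply: le_trans xw _; rewrite lerDl mulr_ge0 ?powR_ge0.
apply: (@le_trans _ _ (K * x `^ p)); last by rewrite lerDr ltW.
rewrite -mulr_powRB1 //; last exact: lt_trans p1.
rewrite mulrCA ler_peMr //; apply: le_trans Kw _; rewrite ler_wpM2l //.
by apply: ge0_ler_powR; rewrite ?nnegrE ?subr_ge0 ?(ltW p1) ?(ltW w0) ?(ltW wx).
Qed.

(** * Trees with prescribed level sizes, each dividing the next *)

Section DivTree.
Variable N : nat -> nat.
Hypothesis N0 : N 0%N = 1%N.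
Hypothesis N_gt0 : forall k, (0 < N k)%N.
Hypothesis N_dvd : forall k, (N k %| N k.+1)%N.

(* The vertex [(k, i)] is the [i]-th one at distance [k] from the root; its
   parent is found by reducing [i] modulo [N k.-1]. *)
Definition div_vertex := {x : nat * nat | (x.2 < N x.1)%N}.

Definition vlevel (v : div_vertex) : nat := (val v).1.

Definition vindex (v : div_vertex) : nat := (val v).2.

Definition mkv k i : div_vertex :=
  exist (fun x : nat * nat => (x.2 < N x.1)%N) (k, (i %% N k)%N)
    (ltn_pmod i (N_gt0 k)).

Definition div_par (v : div_vertex) : div_vertex :=
  mkv (vlevel v).-1 (vindex v).

Lemma vindex_lt v : (vindex v < N (vlevel v))%N. Proof. exact: (valP v). Qed.

Lemma vertex_ext v w : vlevel v = vlevel w -> vindex v = vindex w -> v = w.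
Proof.
move=> vw1 vw2; apply: val_inj; rewrite (surjective_pairing (val v)).
by rewrite (surjective_pairing (val w)); congr pair.
Qed.

Lemma vlevel_eq0 v : (vlevel v == 0%N) = (v == mkv 0 0).
Proof.
apply/eqP/eqP => [v0|-> //]; apply: vertex_ext => //=.
by have := vindex_lt v; rewrite v0 N0 /vindex /= mod0n; lia.
Qed.

Lemma vlevel_par v : vlevel (div_par v) = (vlevel v).-1. Proof. by []. Qed.

Definition div_tree : rooted_tree := parent_tree vlevel_eq0 vlevel_par.

Local Notation T := div_tree.
Local Notation is_child := (is_child vlevel div_par).

Lemma div_is_child u v : is_child u v <->
  vlevel v = (vlevel u).+1 /\ (vindex v %% N (vlevel u) = vindex u)%N.
Proof.
split=> [/andP[/eqP vu /eqP dv]|[dv iv]].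
  by split=> //; rewrite -[in RHS]vu [in RHS]/vindex /= dv.
apply/andP; split; last exact/eqP; apply/eqP; apply: vertex_ext.
  by rewrite vlevel_par dv.
by rewrite -iv {1}/vindex /= dv.
Qed.

Definition branching k := (N k.+1 %/ N k)%N.

Lemma branchingE k : N k.+1 = (branching k * N k)%N.
Proof. by rewrite /branching divnK. Qed.

Lemma branching_gt0 k : (0 < branching k)%N.
Proof. by have := N_gt0 k.+1; rewrite branchingE muln_gt0 => /andP[]. Qed.

(** The indices at the next level that reduce to that of [u] are its translates by multiples of
    [N (vlevel u)]; they are distinct for [j] below the branching number and wrap around
    afterwards. *)
Definition nth_child (u : div_vertex) j : div_vertex :=
  mkv (vlevel u).+1 (vindex u + j * N (vlevel u)).

Lemma nth_child_index u j : (j < branching (vlevel u))%N ->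
  vindex (nth_child u j) = (vindex u + j * N (vlevel u))%N.
Proof.
move=> jD; rewrite /vindex /= modn_small //= branchingE.
have := vindex_lt u; rewrite /vindex; move: (N _) (branching _) jD => M D jD.
by nia.
Qed.

Lemma nth_child_is_child u j : (j < branching (vlevel u))%N ->
  is_child u (nth_child u j).
Proof.
move=> jD; apply/div_is_child; split=> //; rewrite nth_child_index //.
by rewrite addnC modnMDl modn_small // vindex_lt.
Qed.

Lemma card_is_child u :
  ([set v | is_child u v] #= `I_(branching (vlevel u)))%card.
Proof.
(* All children of [u] have the same remainder modulo [N (vlevel u)], namely the index of [u], so
   the quotient determines the child. *)
have inj : {in [set v | is_child u v] &,
    injective (fun v => vindex v %/ N (vlevel u))%N}.
  move=> v w /set_mem/div_is_child[dv iv] /set_mem/div_is_child[dw iw] vw.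
  apply: vertex_ext; first by rewrite dv.
  by rewrite (divn_eq (vindex v) (N (vlevel u))) vw iv -iw -divn_eq.
rewrite card_eq_sym; apply: card_eq_trans (inj_card_eq inj).
suff -> : [set vindex v %/ N (vlevel u) | v in [set v | is_child u v]]%N =
  `I_(branching (vlevel u)) by exact: card_eqxx.
have Nu := N_gt0 (vlevel u); apply/seteqP; split=> j /=.
  case=> v /div_is_child[dv iv] <-.
  by have := vindex_lt v; rewrite dv branchingE ltn_divLR.
move=> jD; exists (nth_child u j); first exact: nth_child_is_child.
by rewrite nth_child_index // addnC divnMDl // divn_small ?addn0 // vindex_lt.
Qed.
Lemma level_bij k : set_bij `I_(N k) [set v | vlevel v = k] (mkv k).
Proof.
split=> [i //|i j /set_mem ik /set_mem jk /(congr1 vindex)|v /= vk].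
  by rewrite /vindex /= !modn_small.
exists (vindex v) => /=; first by rewrite -vk vindex_lt.
by apply: vertex_ext; rewrite -?vk // {1}/vindex /= modn_small // vindex_lt.
Qed.

Lemma finite_level k : finite_set [set v | vlevel v = k].
Proof.
have [_ _ sur] := level_bij k.
by apply: sub_finite_set (finite_image (mkv k) (finite_II (N k))) => v /sur.
Qed.

Lemma finite_levels n : finite_set [set v | (vlevel v < n)%N].
Proof.
apply: (@sub_finite_set _ _ (\bigcup_(k in `I_n) [set v | vlevel v = k])).
  by move=> v vn; exists (vlevel v).
by apply: bigcup_finite => // k _; exact: finite_level.
Qed.

Lemma esum_level (R : realType) k (c : R) : 0 <= c ->
  (\esum_(v in [set v | vlevel v = k]) c%:E = ((N k)%:R * c)%:E)%E.
Proof.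
move=> c0; rewrite (reindex_esum _ _ _ _ (level_bij k)) esum_fset //.
by rewrite -fsbig_ord sumEFin sumr_const card_ord mulr_natl.
Qed.

Lemma edge_children_card u : u != mkv 0 0 ->
  (@children T (parent_edge div_par u) #= `I_(branching (vlevel u)))%card.
Proof.
move=> uo; apply: card_eq_trans (card_is_child u).
exact: (children_card vlevel_eq0 vlevel_par).
Qed.

Lemma div_tree_proper : proper_infinite_tree T.
Proof.
split.
- move=> finT; apply: infinite_nat.
  apply: sub_finite_set (finite_image (fun v : T => vlevel v) finT).
  by move=> k _; exists (mkv k 0).
- move=> x; apply: sub_finite_set (finite_levels (vlevel x).+2) => y /=.
  by case/orP => /is_child_dep ->; [exact: ltnSn | exact: leqW].
- rewrite (parent_tree_edges vlevel_eq0 vlevel_par) => _ [u uo <-].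
  rewrite parent_edge_children //; exists (parent_edge div_par (nth_child u 0)).
  by exists (nth_child u 0) => //=; exact/nth_child_is_child/branching_gt0.
Qed.

Lemma div_tree_one_two : (forall k, (branching k <= 2)%N) -> one_two_tree T.
Proof.
move=> le2; split; first exact: div_tree_proper.
  move=> k e f; rewrite parent_tree_edges_of_gen.
  move=> -[u [uo <-] <-] [v [vo vu] <-].
  apply: card_eq_trans (edge_children_card uo) _.
  by rewrite card_eq_sym -vu; exact: edge_children_card.
move=> e; rewrite (parent_tree_edges vlevel_eq0 vlevel_par) => -[u uo <-].
have := edge_children_card uo.
have := le2 (vlevel u); have := branching_gt0 (vlevel u).
by case: (branching _) => [//|[|[|//]]] _ _; [left|right].
Qed.

(** * Light paths and the lower bound on the modulus *)

(** These are the strict descendants of [u]: since each level size divides the next, successive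
    passages to the parent compose to a single reduction modulo [N (vlevel u)]. *)
Definition below (u : div_vertex) : set div_vertex :=
  [set w | (vlevel u < vlevel w)%N /\ (vindex w %% N (vlevel u) = vindex u)%N].

Lemma below_root : below (mkv 0 0) = [set v | v != mkv 0 0].
Proof.
apply/seteqP; split=> v; rewrite /= -vlevel_eq0 /below /= -lt0n; first by case.
by rewrite /vindex /= N0 !modn1.
Qed.

(* Averaging over the children: some child subtree carries at most its share
   of the total mass. *)
Lemma light_child (R : realType) (g : div_vertex -> \bar R) u :
  (forall v, 0 <= g v)%E -> exists2 v, is_child u v &
  ((N (vlevel v))%:R%:E * (g v + \esum_(w in below v) g w) <=
     (N (vlevel u))%:R%:E * \esum_(w in below u) g w)%E.
Proof.
move=> g0; set k := vlevel u; set D := branching k.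
(* For [j < D], [J j] is the [j]-th child of [u] together with its strict descendants. *)
pose J j := [set w : div_vertex | (k < vlevel w)%N /\
  (vindex w %% N k.+1 = vindex u + j * N k)%N].
have [j jD le] := le_mean_argmin (branching_gt0 k)
  (fun j => esum_ge0 (S := J j) (fun v _ => g0 v)).
have cj := nth_child_is_child jD; exists (nth_child u j) => //.
have cJ : (g (nth_child u j) + \esum_(w in below (nth_child u j)) g w <=
    \esum_(w in J j) g w)%E.
  rewrite (esumID [set nth_child u j] (J j)) // leeD //.
    rewrite -(esum_set1 (g0 (nth_child u j))); apply: le_esum_subset.
    move=> _ ->; split=> //; split=> //.
    rewrite nth_child_index // modn_small // -(nth_child_index jD).
    exact: vindex_lt.
  apply: le_esum_subset => w [lw iw]; split.
    by split; [exact: ltnW|rewrite -(nth_child_index jD)].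
  by move=> /= wE; move: lw; rewrite wE ltnn.
(* The sets [J j] are disjoint parts of [below u]. *)
have Ju : (\sum_(j < D) \esum_(w in J j) g w <= \esum_(w in below u) g w)%E.
  rewrite (fsbig_ord _ _ (fun j => \esum_(w in J j) g w)%E).
  rewrite -esum_fset //; last first.
    by move=> i _; exact: esum_ge0.
  rewrite -esum_bigcupT //; last first.
    move=> i i' _ _ [w [[_ wi] [_]]]; rewrite wi => /eqP.
    by rewrite eqn_add2l eqn_mul2r eqn0Ngt N_gt0 /= => /eqP.
  apply: le_esum_subset => w [i iD [kw iw]]; split=> //.
  by rewrite -(modn_dvdm _ (N_dvd k)) iw addnC modnMDl modn_small // vindex_lt.
rewrite (is_child_dep cj) branchingE natrM EFinM -muleA -/k -/D muleCA.
rewrite lee_wpmul2l //; apply: le_trans Ju; apply: le_trans le.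
by rewrite lee_wpmul2l.
Qed.

Lemma light_path (R : realType) (g : div_vertex -> \bar R) :
  (forall v, 0 <= g v)%E -> exists v : nat -> div_vertex,
  [/\ v 0%N = mkv 0 0, forall i, is_child (v i) (v i.+1) &
   forall n, (\sum_(i < n) (N i.+1)%:R%:E * g (v i.+1) <=
     \esum_(w in [set w | w != mkv 0 0]) g w)%E].
Proof.
move=> g0; have /choice[c cP] : forall u, exists v, is_child u v /\
  ((N (vlevel v))%:R%:E * (g v + \esum_(w in below v) g w) <=
     (N (vlevel u))%:R%:E * \esum_(w in below u) g w)%E.
  by move=> u; have [v uv le] := light_child u g0; exists v.
pose v n := iter n c (mkv 0 0).
have vc i : is_child (v i) (v i.+1) by have [] := cP (v i).
have lv i : vlevel (v i) = i.
  by elim: i => // i IH; rewrite (is_child_dep (vc i)) IH.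
exists v; split=> // n; rewrite -below_root.
(* Adding [N n] times the mass below [v n] gives a quantity that starts at the total mass and, by
   [light_child], never increases with [n]. *)
apply: (@le_trans _ _ (\sum_(i < n) (N i.+1)%:R%:E * g (v i.+1) +
    (N n)%:R%:E * \esum_(w in below (v n)) g w)%E).
  by rewrite leeDl // mule_ge0 // esum_ge0.
elim: n => [|n IH]; first by rewrite big_ord0 add0e N0 mul1e.
apply: le_trans IH; rewrite big_ord_recr /= -addeA leeD2l //.
have [_] := cP (v n); rewrite -[c (v n)]/(v n.+1) !lv.
by rewrite ge0_muleDr // esum_ge0.
Qed.

(** Testing admissibility on one light path gives 1 <= 1/2 + C E for the energy E, hence the lower
    bound 1/(2C). The weight [w k] belongs to the edge of generation k+1, whence the shift in
    [N k.+1]. *)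
Lemma div_modulus_gt0 (R : realType) (p C : R) (w : nat -> R) :
  1 < p -> 0 < C -> (forall k, 0 < w k) ->
  (forall n, \sum_(i < n) w i <= 2^-1) ->
  (forall k, 1 <= C * (N k.+1)%:R * w k `^ (p - 1)) ->
  (0 < modulus T p)%E.
Proof.
move=> p1 C0 w0 sw Cw; apply: (@lt_le_trans _ _ ((2 * C)^-1)%:E).
  by rewrite lte_fin invr_gt0 mulr_gt0.
apply/ereal_infP => _ [rho [drho adm] <-].
rewrite (esum_parent_tree_edges vlevel_eq0 vlevel_par).
set ev := parent_edge div_par.
have [v [v0 vc le]] := light_path (g := fun v => (rho (ev v) `^ p)%:E)
  (fun v => powR_ge0 _ _).
set E := esum _ _ in le *.
have path_v : @infinite_descending_paths T (fun i => ev (v i.+1)).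
  exact: (descending_of_vertices vlevel_eq0 vlevel_par).
have rho0 i : 0 <= rho (ev (v i.+1)).
  apply: drho; rewrite (parent_tree_edges vlevel_eq0 vlevel_par).
  by exists (v i.+1) => //; exact: (is_child_neq_root vlevel_eq0 (vc i)).
have bound : (rho_length rho (fun i => ev (v i.+1)) <= (2^-1)%:E + C%:E * E)%E.
  apply: lime_le; first by apply: is_cvg_nneseries => i _ _; rewrite lee_fin.
  apply: nearW => n; rewrite big_mkord.
  apply: (@le_trans _ _ ((\sum_(i < n) w i)%:E + C%:E *
    (\sum_(i < n) (N i.+1)%:R%:E * (rho (ev (v i.+1)) `^ p)%:E))%E).
    rewrite [X in (_ * X)%E](eq_bigr (fun i : 'I_n =>
      ((N i.+1)%:R * rho (ev (v i.+1)) `^ p)%:E)) => [|i _];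
      last by rewrite EFinM.
    rewrite !sumEFin -EFinM -EFinD lee_fin mulr_sumr -big_split /=.
    by apply: ler_sum => i _; rewrite mulrA le_weight_powR.
  apply: leeD; first by rewrite lee_fin.
  by apply: lee_wpmul2l => //; rewrite lee_fin ltW.
have := le_trans (adm _ path_v) bound.
case: E {le bound} => [x| |] /=; last 2 first.
- by rewrite leey.
- by rewrite gt0_muleNy ?lte_fin // addeNy.
rewrite -EFinM -EFinD !lee_fin => le1.
by rewrite invfM -ler_pdivlMr ?invr_gt0 // invrK; lra.
Qed.

(** * The upper bound on the modulus *)

Lemma N_homo : {homo N : i j / (i <= j)%N}.
Proof. by apply: homo_leq (@leqnn) leq_trans _ => i; exact: dvdn_leq. Qed.

Lemma div_modulus_le (R : realType) (p : R) n : 0 < p -> (0 < n)%N ->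
  (modulus T p <= (n%:R * (N n)%:R * (n%:R^-1) `^ p)%:E)%E.
Proof.
move=> p0 n0; have nV0 : 0 <= n%:R^-1 :> R by rewrite invr_ge0.
pose rho (e : set T) : R :=
  if `[< exists2 k, (k <= n)%N & @edges_of_gen T k e >] then n%:R^-1 else 0.
have rho0 e : 0 <= rho e by rewrite /rho; case: ifP.
have rho_adm : @admissible T R rho.
  split=> // gamma path_gamma.
  apply: le_trans (nneseries_lim_ge n _); last by move=> *; rewrite lee_fin.
  rewrite big_mkord (eq_bigr (fun=> (n%:R^-1)%:E)); last first.
    move=> i _; rewrite /rho; case: asboolP => // -[]; exists i.+1 => //.
    exact: (descending_gen (dep_eq0 := vlevel_eq0) (dep_par := vlevel_par)).
  rewrite sumEFin sumr_const card_ord -(mulr_natl n%:R^-1 n).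
  by rewrite divff ?pnatr_eq0 -?lt0n.
apply: (@le_trans _ _ (\esum_(e in @edges T) (rho e `^ p)%:E)%E).
  by apply: ereal_inf_lbound; exists rho.
rewrite (esum_parent_tree_edges vlevel_eq0 vlevel_par).
set c := n%:R^-1 `^ p; have c0 : 0 <= c by exact: powR_ge0.
(* The lower endpoints of the edges of generations 1 to n fill the levels [L 0] to [L n.-1]. *)
pose L k := [set v : div_vertex | vlevel v = k.+1].
apply: (@le_trans _ _ (\esum_(v in \bigcup_(k in `I_n) L k) c%:E)%E).
  rewrite [leRHS]esum_mkcond [leLHS]esum_mkcond; apply: le_esum => v _.
  case: ifPn => // vo; last by case: ifP; rewrite ?lee_fin.
  rewrite /rho; case: asboolP => [[k kn]|_]; last first.
    by rewrite powR0 ?gt_eqF //; case: ifP; rewrite ?lee_fin.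
  rewrite (parent_tree_edges_of_gen vlevel_eq0 vlevel_par) => -[v' [v'o v'k]].
  move: vo; rewrite inE /= => vo.
  move/(parent_edge_inj vlevel_eq0 vlevel_par v'o vo) => vE.
  rewrite ifT // inE; exists (vlevel v).-1 => /=.
    by move: (dep_gt0 vlevel_eq0 vo) kn; rewrite -v'k vE; lia.
  by rewrite /L /= prednK // (dep_gt0 vlevel_eq0).
rewrite esum_bigcupT //; last first.
  by move=> i j _ _ [w [/= wi wj]]; apply: succn_inj; rewrite -wi -wj.
rewrite esum_fset //; last by move=> i _; apply: esum_ge0 => *; rewrite lee_fin.
rewrite -fsbig_ord (eq_bigr (fun k : 'I_n => ((N k.+1)%:R * c)%:E)); last first.
  by move=> k _; rewrite esum_level.
rewrite sumEFin lee_fin -mulr_suml ler_wpM2r //.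
rewrite mulr_natl -[in leRHS](card_ord n) -sumr_const; apply: ler_sum => k _.
by rewrite ler_nat; apply: N_homo; rewrite card_ord.
Qed.

End DivTree.

(** * Greedy doublings below a growth function *)

Section GreedyDoubling.
Variables (R : realType) (f : nat -> R).

Fixpoint greedy k : nat :=
  if k is k'.+1 then
    if (2 * greedy k')%:R <= f k then (2 * greedy k')%N else greedy k'
  else 1%N.

Lemma greedy_double k :
  exists2 d, (0 < d <= 2)%N & greedy k.+1 = (d * greedy k)%N.
Proof.
by move=> /=; case: ifP => _; [exists 2%N|exists 1%N; rewrite ?mul1n].
Qed.

Lemma greedy_gt0 k : (0 < greedy k)%N.
Proof.
elim: k => // k IH; have [d /andP[d0 _] ->] := greedy_double k.
by rewrite muln_gt0 d0.
Qed.

Lemma greedy_dvd k : (greedy k %| greedy k.+1)%N.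
Proof. by have [d _ ->] := greedy_double k; exact: dvdn_mull. Qed.

Lemma greedy_branching k : (branching greedy k <= 2)%N.
Proof.
have [d /andP[_ d2] dE] := greedy_double k.
by rewrite /branching dE mulnK ?greedy_gt0.
Qed.

(** After a doubling, the upper bound persists because [f] at most doubles; without one, the failed
    test is itself the upper bound, and the lower one persists by monotonicity. *)
Lemma greedy_bounds k : f 0%N = 1 -> (forall k, f k <= f k.+1) ->
  (forall k, f k.+1 <= 2 * f k) ->
  (greedy k)%:R <= f k /\ f k < 2 * (greedy k)%:R.
Proof.
move=> f0 fle f2; elim: k => [|k [IH1 IH2]]; first by rewrite f0 /=; split; lra.
move: (fle k) (f2 k) => fk fk2 /=; case: ifPn; rewrite -?ltNge natrM => le.
  by split; lra.
by split; lra.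
Qed.

End GreedyDoubling.

(** * A difference estimate for negative powers *)

(** Weights defined as such differences have telescoping sums, while this keeps them above a
    multiple of x^(-(1+eta)). With y = h/x <= h and s = y/(1+h), one has ln(1+y) >= s, so (1+y)^eta
    >= 1 + eta s, and s <= h bounds the remaining denominator. *)
Lemma powR_diff_ge (R : realType) (eta h x : R) : 0 < eta -> 0 < h -> 1 <= x ->
  eta * h / ((1 + h) * (1 + eta * h)) * x `^ (- (1 + eta)) <=
  x `^ (- eta) - (x + h) `^ (- eta).
Proof.
move=> e0 h0 x1; have x0 : 0 < x by lra.
have eh0 : 0 < eta * h by exact: mulr_gt0.
pose y := h / x; have y0 : 0 < y by exact: divr_gt0.
have yh : y <= h by rewrite ler_pdivrMr // ler_peMr // ltW.
pose s := y / (1 + h).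
have s0 : 0 < s by rewrite divr_gt0 //; lra.
have sh : s <= h by rewrite ler_pdivrMr; [nra|lra].
have lny : s <= ln (1 + y).
  (* The bound ln(1+t) <= t is applied at t = 1/(1+y) - 1 to get ln(1+y) >= y/(1+y). *)
  have : ln ((1 + y)^-1) <= (1 + y)^-1 - 1.
    rewrite -[X in ln X](subrK 1) addrC; apply: le_ln1Dx.
    have : 0 < (1 + y)^-1 by rewrite invr_gt0; lra.
    lra.
  rewrite lnV ?posrE; last by lra.
  have : s <= 1 - (1 + y)^-1.
    have -> : 1 - (1 + y)^-1 = y / (1 + y) by field; lra.
    by rewrite ler_pM2l // lef_pV2 ?posrE; lra.
  lra.
have es0 : 0 < eta * s by exact: mulr_gt0.
have pow_y : 1 + eta * s <= (1 + y) `^ eta.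
  rewrite /powR gt_eqF; last by lra.
  apply: le_trans (expR_ge1Dx _); rewrite lerD2l ler_pM2l //.
have -> : x + h = x * (1 + y) by rewrite /y; field; lra.
rewrite powRM; [|lra|lra].
have -> : x `^ (- (1 + eta)) = x `^ (- eta) / x.
  by rewrite opprD addrC powRD ?powR_inv1 ?(ltW x0) // (gt_eqF x0) implybT.
have xe0 : 0 < x `^ (- eta) by exact: powR_gt0.
rewrite -[X in _ <= X - _]mulr1 -mulrBr mulrCA ler_pM2l //.
have : (1 + y) `^ (- eta) <= (1 + eta * s)^-1.
  by rewrite powRN lef_pV2 ?posrE ?powR_gt0; lra.
suff : eta * h / ((1 + h) * (1 + eta * h)) / x <= 1 - (1 + eta * s)^-1 by lra.
have -> : 1 - (1 + eta * s)^-1 = (eta * s) / (1 + eta * s) by field; lra.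
have -> : eta * h / ((1 + h) * (1 + eta * h)) / x = (eta * s) / (1 + eta * h).
  rewrite /s /y; field; do ?[split]; lra.
rewrite ler_pM2l // lef_pV2 ?posrE; nra.
Qed.

(** * The tree of polynomial growth and its critical exponent *)

Section PolynomialGrowth.
Variables (R : realType) (r : R).
Hypothesis r_gt1 : 1 < r.

Let h : R := 2 `^ (r - 1)^-1 - 1.
Let pos k : R := 1 + h * k%:R.
Let f k : R := pos k `^ (r - 1).

Let h_gt0 : 0 < h.
Proof.
rewrite subr_gt0 -[ltLHS](congr1 (fun g => g (r - 1)^-1) (@powR1 R)).
by apply: gt0_ltr_powR; rewrite ?nnegrE ?invr_gt0 ?subr_gt0 ?ltr1n.
Qed.

Let pos_ge1 k : 1 <= pos k.
Proof. by rewrite lerDl mulr_ge0 // ltW. Qed.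

Let pos_ge0 k : 0 <= pos k. Proof. exact: le_trans (pos_ge1 k). Qed.

Let posS k : pos k.+1 = pos k + h.
Proof. by rewrite /pos -natr1; ring. Qed.

Let f_powR1h : (1 + h) `^ (r - 1) = 2.
Proof.
by rewrite /h addrC subrK -powRrM mulVf ?powRr1 // subr_eq0 gt_eqF.
Qed.

(* The step [h] is chosen so that [(1 + h)^(r-1) = 2]: then [f] never grows by
   more than a factor 2 and the greedy sequence stays within a factor 2 of it. *)
Let growth k : (greedy f k)%:R <= f k /\ f k < 2 * (greedy f k)%:R.
Proof.
have r0 : 0 <= r - 1 by rewrite subr_ge0 ltW.
apply: greedy_bounds => [|j|j].
- by rewrite /f /pos mulr0 addr0 powR1.
- by apply: ge0_ler_powR => //; rewrite ?nnegrE // posS lerDl ltW.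
- have h1 : 0 <= 1 + h by rewrite addr_ge0 // ltW.
  rewrite -f_powR1h -powRM //; apply: ge0_ler_powR; rewrite ?nnegrE ?mulr_ge0 //.
  by rewrite posS mulrDl mul1r lerD2l ler_peMr // ltW.
Qed.

Definition growth_tree : rooted_tree :=
  div_tree (erefl : greedy f 0 = 1%N) (greedy_gt0 f).

Lemma growth_tree_one_two : one_two_tree growth_tree.
Proof.
by apply: div_tree_one_two; [exact: greedy_dvd|exact: greedy_branching].
Qed.

Lemma growth_modulus_gt0 p : 1 < p < r -> (0 < modulus growth_tree p)%E.
Proof.
case/andP=> p1 pr; pose eta := (r - 1) / (p - 1) - 1.
have eta0 : 0 < eta by rewrite subr_gt0 ltr_pdivlMr ?subr_gt0 // mul1r ltrD2r.
pose c := eta * h / ((1 + h) * (1 + eta * h)).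
have eh0 : 0 < eta * h by exact: mulr_gt0.
have c0 : 0 < c by apply: divr_gt0 => //; apply: mulr_gt0; exact: addr_gt0.
have c20 : 0 < 2^-1 * c by exact: mulr_gt0.
have pos_gt0 k : 0 < pos k by exact: lt_le_trans (pos_ge1 k).
pose w k := 2^-1 * (pos k.+1 `^ (- eta) - pos k.+2 `^ (- eta)).
have w_ge k : 2^-1 * c * pos k.+1 `^ (- (1 + eta)) <= w k.
  by rewrite /w -mulrA ler_pM2l // [pos k.+2]posS; exact: powR_diff_ge.
have w_gt0 k : 0 < w k.
  by apply: lt_le_trans (w_ge k); apply: mulr_gt0 => //; exact: powR_gt0.
pose D := (2^-1 * c) `^ (p - 1).
have D0 : 0 < D by exact: powR_gt0.
(* In [C], the 2 is the loss between [greedy f] and [f], and [D] is the constant of [w_ge] raised to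
   the power p-1. *)
apply: (div_modulus_gt0 _ _ (greedy_dvd f) (C := 2 / D) (w := w)) => //.
- by rewrite divr_gt0.
- move=> n; rewrite -mulr_sumr ler_piMr //.
  rewrite -(big_mkord xpredT
    (fun k => pos k.+1 `^ (- eta) - pos k.+2 `^ (- eta))).
  rewrite (eq_bigr (fun k => - pos k.+2 `^ (- eta) - (- pos k.+1 `^ (- eta)))).
    rewrite (telescope_sumr (fun k => - pos k.+1 `^ (- eta))) //.
    have : pos 1 `^ (- eta) <= 1.
      by rewrite -[leRHS](powRr0 (pos 1)) ler_powR // oppr_le0 ltW.
    have := powR_ge0 (pos n.+1) (- eta).
    lra.
  by move=> k _; rewrite opprK addrC.
- move=> k; have [_] := growth k.+1; rewrite /f => lt.
  have : D * pos k.+1 `^ (- (r - 1)) <= w k `^ (p - 1).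
    have -> : - (r - 1) = - (1 + eta) * (p - 1) by rewrite /eta; field; lra.
    rewrite /D powRrM -powRM ?powR_ge0 ?(ltW c20) //.
    apply: ge0_ler_powR; rewrite ?nnegrE ?subr_ge0 ?(ltW p1) ?(ltW (w_gt0 _)) //.
    by apply: mulr_ge0; [exact: ltW|exact: powR_ge0].
  have P0 : 0 < pos k.+1 `^ (r - 1) by exact: powR_gt0.
  rewrite powRN ler_pdivrMr // => le.
  rewrite -mulrA mulrAC ler_pdivlMr // mul1r mulrA; apply: le_trans le _.
  by rewrite mulrC ler_wpM2r ?powR_ge0 // ltW.
Qed.

Lemma growth_modulus_eq0 p : r < p -> modulus growth_tree p = 0%E.
Proof.
move=> rp; have r0 : 0 < r by exact: lt_trans r_gt1.
have pr0 : 0 < p - r by rewrite subr_gt0.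
apply/eqP; rewrite eq_le; apply/andP; split; last first.
  apply/ereal_infP => _ [rho _ <-]; apply: esum_ge0 => e _.
  by rewrite lee_fin powR_ge0.
apply/lee_addgt0Pr => e e0; rewrite add0e.
(* The energy bound will be 2 n^(r-p), which is at most [e] as soon as n >= x. *)
pose x := (2 / e) `^ (p - r)^-1; pose n := (Num.truncn x).+1.
have n_gt0 : 0 < n%:R :> R by rewrite ltr0n.
apply: le_trans (div_modulus_le _ _ (greedy_dvd f) _ (ltn0Sn _ : (0 < n)%N)) _.
  exact: lt_trans rp.
rewrite lee_fin.
apply: (@le_trans _ _ (n%:R * (2 * n%:R `^ (r - 1)) * n%:R^-1 `^ p)).
  rewrite ler_wpM2r ?powR_ge0 // ler_wpM2l //.
  (* As n >= 1, 1 + h n <= (1+h) n, whose power r-1 is 2 n^(r-1) by the choice of [h]. *)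
  apply: le_trans (growth n).1 _; rewrite -f_powR1h -powRM //; last first.
    by rewrite addr_ge0 // ltW.
  apply: ge0_ler_powR; rewrite ?nnegrE ?subr_ge0 ?(ltW r_gt1) //.
    by rewrite mulr_ge0 // addr_ge0 // ltW.
  by rewrite mulrDl mul1r lerD2r ler1n.
rewrite mulrCA mulr_powRB1 // -powR_inv1 // -powRrM mulN1r -mulrA.
rewrite -powRD ?(gt_eqF n_gt0) ?implybT //.
rewrite -[r - p]opprB powRN ler_pdivrMr ?powR_gt0 //.
rewrite mulrC -ler_pdivrMr //.
have -> : 2 / e = x `^ (p - r).
  by rewrite -powRrM mulVf ?gt_eqF // powRr1 // divr_ge0 ?ltW.
by apply: ge0_ler_powR; rewrite ?nnegrE ?powR_ge0 ?ltW // truncnS_gt.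
Qed.

Lemma growth_critical_exponent : critical_exponent growth_tree R = r%:E.
Proof.
have mem p : 1 < p < r -> @positive_modulus_exponents growth_tree R p.
  by move=> /[dup] /andP[p1 _] /growth_modulus_gt0.
(* The midpoint witnesses that the set of exponents is nonempty, which excludes the conventional
   value 1. *)
pose m := (1 + r) / 2; have mr : 1 < m < r by rewrite !midf_lt.
rewrite /critical_exponent; case: eqP => [E|_].
  by have := mem _ mr; rewrite E.
apply/eqP; rewrite eq_le; apply/andP; split.
  apply: ge_ereal_sup => _ [p [_ mod_gt0] <-]; rewrite lee_fin leNgt.
  by apply/negP => /growth_modulus_eq0 E; move: mod_gt0; rewrite E ltxx.
(* For large [e], r - e may fall to 1 or below; the maximum with [m] stays strictly between 1 and
   r. *)
apply/lee_subgt0Pr => e e0; apply: (@le_trans _ _ (Num.max m (r - e))%:E).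
  by rewrite -EFinB lee_fin le_max lexx orbT.
apply: ereal_sup_ubound; exists (Num.max m (r - e)) => //; apply: mem.
by case/andP: mr => m1 mr; rewrite lt_max m1 /= gt_max mr ltrBlDr ltrDl.
Qed.

End PolynomialGrowth.

Theorem theorem3 (R : realType) (r : R) (hr : 1 < r) :
  exists T : rooted_tree, one_two_tree T /\ critical_exponent T R = r%:E.
Proof.
exists (growth_tree r); split; first exact: growth_tree_one_two.
exact: growth_critical_exponent.
Qed.
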